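(* For every $p\in(1,\infty]$ and every integer $m\ge 2$, the Banach space $\mathrm{JL}_p(\mathcal A_m)$ is isomorphic to $\mathrm{JL}_p(\mathcal A_2)$, where $\mathcal A_m$ is the almost disjoint family of branches of the full $m$-adic tree $m^{<\omega}$.
   Context: An almost disjoint (AD) family on a countable set $N$ is a family $\mathcal A$ of infinite subsets of $N$ such that $A\cap B$ is finite for any distinct $A,B\in\mathcal A$. The space $\psi(\mathcal A)=N\cup\mathcal A$ is topologized so that points of $N$ are isolated and the sets $\{A\}\cup(A\setminus F)$, $F\subseteq N$ finite, form a local base at $A\in\mathcal A$; $K_{\mathcal A}=\psi(\mathcal A)\cup\{\infty\}$ is the one-point compactification of this locally compact space. $C(K_{\mathcal A})$ is the Banach space of real-valued continuous functions on $K_{\mathcal A}$ with the supremum norm $\|\cdot\|_\infty$. For $1<p<\infty$ and $f\in C(K_{\mathcal A})$ put $\|f\|_p'=\big(\sum_{A\in\mathcal A}|f(A)|^p\big)^{1/p}$ and $\|f\|_p=\max\{\|f\|_\infty,\|f\|_p'\}$; then $\mathrm{JL}_p(\mathcal A)=\{f\in C(K_{\mathcal A}):\|f\|_p'<\infty\}$ with norm $\|\cdot\|_p$. For $p=\infty$, $\mathrm{JL}_\infty(\mathcal A)=C(K_{\mathcal A})$ with the supremum norm. $m^{<\omega}$ is the set of finite sequences with entries in $\{0,\dots,m-1\}$; $\mathcal A_m=\{B(x):x\in m^\omega\}$ is an AD family on $m^{<\omega}$, where $B(x)=\{x|n:n\in\omega\}$ is the set of all finite initial segments of $x$. ''Isomorphic''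 means linearly homeomorphic. *)

(* Defs.v *)
From HB Require Import structures.
From mathcomp Require Import all_boot all_order all_algebra.
From mathcomp Require Import all_classical all_reals all_analysis.
From mathcomp Require Import ring lra.

Set Implicit Arguments.
Unset Strict Implicit.
Unset Printing Implicit Defensive.

Import Order.TTheory GRing.Theory Num.Theory.
Import numFieldNormedType.Exports.

Local Open Scope classical_set_scope.
Local Open Scope ring_scope.

Section RealContinuous.
Variables (R : realType) (T : topologicalType).
Implicit Types f g : T -> R.

Lemma continuous_real0 : continuous (0 : T -> R).
Proof. by move=> x; exact: cvg_cst. Qed.

Lemma continuous_realD f g : continuous f -> continuous g -> continuous (f + g).
Proof. by move=> cf cg x; apply: cvgD; [exact: cf|exact: cg]. Qed.

Lemma continuous_realZ (a : R) f : continuous f -> continuous (a *: f).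
Proof. by move=> cf x; apply: cvgZl_tmp; exact: cf. Qed.

End RealContinuous.

Section AlmostDisjoint.
Variable N : countType.

Definition almost_disjoint (AA : set (set N)) : Prop :=
  (forall A, AA A -> infinite_set A) /\
  (forall A B, AA A -> AA B -> A <> B -> finite_set (A `&` B)).

(* inl n is the isolated point n and inr A the point A; a neighborhood of A
   contains A together with all but finitely many elements of A. *)
Definition psi (AA : set (set N)) : Type := (N + AA)%type.

Variable AA : set (set N).

HB.instance Definition _ := Choice.on (psi AA).

Definition psi_nbhs (x : psi AA) : set_system (psi AA) :=
  match x with
  | inl n => [set U | U (inl n)]
  | inr A => filter_from finite_set
               (fun F => [set inr A] `|` inl @` (val A `\` F))
  end.

Let psi_filter (x : psi AA) : ProperFilter (psi_nbhs x).
Proof.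
case: x => [n|A] /=.
  apply: Build_ProperFilter => //; split=> // P Q PQ; exact: PQ.
apply: filter_from_proper; last by move=> F _; exists (inr A); left.
apply: filter_from_filter; first by exists set0; exact: finite_set0.
move=> F G fF fG; exists (F `|` G); first by rewrite finite_setU.
move=> x [->|[n [An /not_orP[nF nG]] <-]]; first by split; left.
by split; right; exists n.
Qed.

Let psi_singleton (x : psi AA) U : psi_nbhs x U -> U x.
Proof. by case: x => [n|A] //= [F _]; apply; left. Qed.

Let psi_nbhs_nbhs (x : psi AA) U :
  psi_nbhs x U -> psi_nbhs x (psi_nbhs^~ U).
Proof.
case: x => [n|A] //= [F fF FU]; exists F => // y [->|[n An <-]] /=.
  by exists F.
by apply: FU; right; exists n.
Qed.

HB.instance Definition _ := hasNbhs.Build (psi AA) psi_nbhs.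
HB.instance Definition _ := @Nbhs_isNbhsTopological.Build (psi AA)
  psi_filter psi_singleton psi_nbhs_nbhs.

Definition K_space : Type := one_point_compactification (psi AA).

HB.instance Definition _ := Pointed.on K_space.
HB.instance Definition _ := Topological.on K_space.

Definition K_set (A : AA) : K_space := Some (inr A).

End AlmostDisjoint.

Section JohnsonLindenstrauss.
Variables (R : realType) (N : countType) (AA : set (set N)).
Implicit Types (f g : K_space AA -> R) (r : R).

Definition sup_norm f : R := sup (range (fun x => `|f x|)).

(* The p-seminorm over AA, +oo when the sum diverges; the sum is the supremum
   of the sums over finite subfamilies. *)
Definition ell_norm r f : \bar R :=
  ((\esum_(A in [set: AA]) (`|f (K_set A)| `^ r)%:E) `^ r^-1)%E.

Lemma K_space_bounded f : continuous f -> has_ubound (range (fun x => `|f x|)).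
Proof.
move=> cf.
have cK : compact [set: K_space AA] by exact: one_point_compactification_compact.
have : compact (f @` [set: K_space AA]).
  by apply: continuous_compact => //; exact: continuous_subspaceT.
move=> /(@compact_bounded R R) [M [_ MP]]; exists (M + 1) => _ [x _ <-].
by apply: (MP (M + 1)); [rewrite ltrDl|exists x].
Qed.

Lemma sup_norm_ge f x : continuous f -> `|f x| <= sup_norm f.
Proof. by move=> /K_space_bounded bf; apply: ub_le_sup => //; exists x. Qed.

Lemma sup_norm_le f (M : R) : (forall x, `|f x| <= M) -> sup_norm f <= M.
Proof.
move=> fM; apply: ge_sup; first by exists `|f None|; exists None.
by move=> _ [x _ <-].
Qed.

Lemma sup_norm_ge0 f : continuous f -> 0 <= sup_norm f.
Proof. by move=> cf; exact: le_trans (normr_ge0 _) (sup_norm_ge None cf). Qed.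

Lemma sup_normD f g : continuous f -> continuous g ->
  sup_norm (f + g) <= sup_norm f + sup_norm g.
Proof.
move=> cf cg; apply: sup_norm_le => x.
by apply: le_trans (ler_normD _ _) _; apply: lerD; exact: sup_norm_ge.
Qed.

Lemma sup_normZ a f : continuous f -> sup_norm (a *: f) = `|a| * sup_norm f.
Proof.
move=> cf; have caf := continuous_realZ (a := a) cf.
have H b g : continuous g -> sup_norm (b *: g) <= `|b| * sup_norm g.
  move=> cg; apply: sup_norm_le => x.
  by rewrite normrM ler_wpM2l //; exact: sup_norm_ge.
apply/eqP; rewrite eq_le H //=.
have [->|a0] := eqVneq a 0.
  by rewrite normr0 mul0r; apply: sup_norm_ge0; exact: continuous_realZ.
have := H a^-1 _ caf; rewrite scalerA mulVf // scale1r normfV.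
by rewrite mulrC ler_pdivlMr ?normr_gt0 // mulrC.
Qed.

Lemma ell_norm_ge0 r f : (0 <= ell_norm r f)%E.
Proof. exact: poweR_ge0. Qed.

Let ell_sum r f := (\esum_(A in [set: AA]) (`|f (K_set A)| `^ r)%:E)%E.

Let ell_sum_ge0 r f : (0 <= ell_sum r f)%E.
Proof. by apply: esum_ge0 => A _; rewrite lee_fin powR_ge0. Qed.

Let esumZ_le (c : R) (a : AA -> R) : 0 <= c -> (forall A, 0 <= a A) ->
  (\esum_(A in [set: AA]) (c * a A)%:E <=
   c%:E * \esum_(A in [set: AA]) (a A)%:E)%E.
Proof.
move=> c0 a0; apply: ge_ereal_sup => _ [F [fF _] <-].
under eq_fsbigr do rewrite EFinM.
rewrite -ge0_mule_fsumr; last by move=> A; rewrite lee_fin.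
apply: lee_pmul => //; first by apply: fsume_ge0 => A _; rewrite lee_fin.
by apply: ereal_sup_ubound; exists F.
Qed.

Let ell_le r f (a : R) : 0 < r -> 0 <= a ->
  (ell_norm r f <= a%:E)%E = (ell_sum r f <= (a `^ r)%:E)%E.
Proof.
move=> r0 a0; apply/idP/idP => H.
- have -> : ell_sum r f = (ell_norm r f `^ r)%E.
    by rewrite /ell_norm -poweRrM mulVf ?gt_eqF // poweRe1 // ell_sum_ge0.
  rewrite -poweR_EFin; apply: gt0_ler_poweR; rewrite ?(ltW r0) //.
  + by rewrite in_itv /= leey ell_norm_ge0.
  + by rewrite in_itv /= leey lee_fin a0.
- have -> : a%:E = ((a `^ r)%:E `^ r^-1)%E.
    by rewrite poweR_EFin -powRrM mulfV ?gt_eqF // powRr1.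
  apply: gt0_ler_poweR; rewrite ?invr_ge0 ?(ltW r0) //.
  + by rewrite in_itv /= leey ell_sum_ge0.
  + by rewrite in_itv /= leey lee_fin powR_ge0.
Qed.

Lemma ell_normZ_le r a f : 0 < r ->
  (ell_norm r (a *: f) <= `|a|%:E * ell_norm r f)%E.
Proof.
move=> r0.
have -> : (`|a|%:E * ell_norm r f =
           ((`|a| `^ r)%:E * ell_sum r f) `^ r^-1)%E.
  rewrite poweRM ?lee_fin ?powR_ge0 ?ell_sum_ge0 //.
  by rewrite poweR_EFin -powRrM mulfV ?gt_eqF // powRr1.
apply: gt0_ler_poweR; rewrite ?invr_ge0 ?(ltW r0) ?in_itv /= ?leey ?andbT //.
- exact: ell_sum_ge0.
- by rewrite mule_ge0 ?lee_fin ?powR_ge0 ?ell_sum_ge0.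
rewrite [leLHS](_ : _ = \esum_(A in [set: AA])
    (`|a| `^ r * `|f (K_set A)| `^ r)%:E)%E.
  by apply: esumZ_le => [|A]; rewrite powR_ge0.
by apply: eq_esum => A _; rewrite normrM powRM.
Qed.

Lemma ell_normZ r a f : 0 < r ->
  (ell_norm r (a *: f) = `|a|%:E * ell_norm r f)%E.
Proof.
move=> r0; have [->|a0] := eqVneq a 0.
  apply/eqP; rewrite normr0 mul0e eq_le ell_norm_ge0 andbT.
  by have := ell_normZ_le 0 f r0; rewrite normr0 mul0e.
apply/eqP; rewrite eq_le ell_normZ_le //=.
have := ell_normZ_le a^-1 (a *: f) r0; rewrite scalerA mulVf // scale1r.
move=> /(@lee_wpmul2l _ `|a|%:E); rewrite lee_fin => /(_ (normr_ge0 _)).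
by rewrite muleA -EFinM normfV mulfV ?normr_eq0 // mul1e.
Qed.

Lemma ell_normD r f g : 1 <= r ->
  (ell_norm r (f + g)%R <= ell_norm r f + ell_norm r g)%E.
Proof.
move=> r1; have r0 : 0 < r by exact: lt_le_trans r1.
have g0 := ell_norm_ge0 r g; have f0 := ell_norm_ge0 r f.
case fE: (ell_norm r f) f0 => [a| |] // f0; last first.
  by rewrite addye ?leey // gt_eqF // (lt_le_trans _ g0).
case gE: (ell_norm r g) g0 => [b| |] // g0; last by rewrite addey ?leey.
move: f0 g0; rewrite !lee_fin => a0 b0; apply/lee_addgt0Pr => e e0.
pose a' := a + e / 2; pose b' := b + e / 2.
have a'0 : 0 < a' by rewrite /a'; lra.
have b'0 : 0 < b' by rewrite /b'; lra.
rewrite -!EFinD (_ : a + b + e = a' + b'); last by rewrite /a' /b'; lra.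
set s := a' + b'; have s0 : 0 < s by rewrite addr_gt0.
have fa : (ell_sum r f <= (a' `^ r)%:E)%E.
  by rewrite -ell_le ?(ltW a'0) // fE lee_fin /a'; lra.
have gb : (ell_sum r g <= (b' `^ r)%:E)%E.
  by rewrite -ell_le ?(ltW b'0) // gE lee_fin /b'; lra.
rewrite ell_le ?(ltW s0) //.
pose ca := s `^ r * (a' / s) * (a' `^ r)^-1.
pose cb := s `^ r * (b' / s) * (b' `^ r)^-1.
have ca0 : 0 <= ca by rewrite !(mulr_ge0, invr_ge0, powR_ge0) // ltW.
have cb0 : 0 <= cb by rewrite !(mulr_ge0, invr_ge0, powR_ge0) // ltW.
apply: (@le_trans _ _ (ca%:E * ell_sum r f + cb%:E * ell_sum r g)%E).
  apply: (@le_trans _ _ (\esum_(A in [set: AA])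
     ((ca * `|f (K_set A)| `^ r)%:E + (cb * `|g (K_set A)| `^ r)%:E))%E).
    apply: le_esum => A _; rewrite -EFinD lee_fin.
    set x := f _; set y := g _.
    have t0 : 0 <= a' / s by rewrite divr_ge0 // ltW.
    have t1 : a' / s <= 1 by rewrite ler_pdivrMr // mul1r /s lerDl ltW.
    pose t := Itv01 t0 t1.
    have H : ((`|x| + `|y|) / s) `^ r <=
             a' / s * (`|x| / a') `^ r + b' / s * (`|y| / b') `^ r.
      have -> : (`|x| + `|y|) / s = a' / s * (`|x| / a') + b' / s * (`|y| / b').
        by field; rewrite !gt_eqF.
      have -> : b' / s = unstable.onem (a' / s).
        by rewrite /unstable.onem /s; field; rewrite gt_eqF.
      have := @convex_powR R r r1 t (`|x| / a') (`|y| / b').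
      rewrite !inE /= !in_itv /= !andbT !divr_ge0 ?(ltW a'0) ?(ltW b'0) //.
      exact.
    have pV (z c : R) : 0 < c -> (`|z| / c) `^ r = `|z| `^ r / c `^ r.
      move=> c0; rewrite powRM ?invr_ge0 ?(ltW c0) //.
      by rewrite -powR_inv1 ?(ltW c0) // -powRrM mulN1r powRN.
    rewrite !pV // in H.
    apply: (@le_trans _ _ (s `^ r * ((`|x| + `|y|) / s) `^ r)).
      have xy0 : 0 <= (`|x| + `|y|) / s.
        by apply: divr_ge0; [rewrite addr_ge0|exact: ltW].
      rewrite -(powRM _ (ltW s0) xy0).
      rewrite [s * _]mulrC divfK ?gt_eqF //.
      by apply: ge0_ler_powR; rewrite ?nnegrE ?addr_ge0 ?(ltW r0) // ler_normD.
    apply: (le_trans (ler_wpM2l (powR_ge0 s r) H)).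
    by rewrite le_eqVlt; apply/orP; left; apply/eqP; rewrite /ca /cb; ring.
  rewrite esumD; try by move=> A _; rewrite lee_fin mulr_ge0 ?powR_ge0.
  by apply: leeD; apply: esumZ_le => // A; exact: powR_ge0.
apply: (@le_trans _ _ (ca%:E * (a' `^ r)%:E + cb%:E * (b' `^ r)%:E)%E).
  by apply: leeD; apply: lee_wpmul2l; rewrite ?lee_fin.
rewrite -!EFinM -EFinD lee_fin /ca /cb.
rewrite !mulfVK ?gt_eqF ?powR_gt0 // -mulrDr -mulrDl mulfV ?gt_eqF //.
by rewrite mulr1.
Qed.

(* With 1 < p, the second branch is only reached at p = +oo. *)
Definition JL_pred (p : \bar R) : {pred K_space AA -> R} := mem
  [set f : K_space AA -> R | continuous f /\
    (if p is r%:E then (ell_norm r f < +oo)%E else True)].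

Definition JL_norm (p : \bar R) f : R :=
  if p is r%:E then Num.max (sup_norm f) (fine (ell_norm r f))
  else sup_norm f.

Lemma JL_predP (p : \bar R) f : reflect
  (continuous f /\ (if p is r%:E then (ell_norm r f < +oo)%E else True))
  (f \in JL_pred p).
Proof. exact: asboolP. Qed.

(* p1 is a phantom parameter: the norm laws below depend on it. *)
Record JL (p : \bar R) (p1 : (1 < p)%E) : Type := MkJL {
  JL_fun :> K_space AA -> R;
  _ : JL_fun \in JL_pred p
}.

Section JL_space.
Variables (p : \bar R) (p1 : (1 < p)%E).

Fact JL_submod_closed : submod_closed (JL_pred p).
Proof.
split.
  apply/JL_predP; split; first exact: continuous_real0.
  case: p p1 => [r| |] //; rewrite lte_fin => r1.
  have := ell_normZ 0 0 (lt_trans ltr01 r1).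
  by rewrite scale0r normr0 mul0e => ->; rewrite ltry.
move=> a f g /JL_predP[cf Nf] /JL_predP[cg Ng]; apply/JL_predP; split.
  by apply: continuous_realD => //; exact: continuous_realZ.
case: p p1 Nf Ng => [r| |] //; rewrite lte_fin => r1 Nf Ng.
apply: le_lt_trans (ell_normD _ _ (ltW r1)) _.
rewrite (ell_normZ _ _ (lt_trans ltr01 r1)) lte_add_pinfty //.
by rewrite lte_mul_pinfty // ?lee_fin.
Qed.

Fact JL_norm_leD f g : f \in JL_pred p -> g \in JL_pred p ->
  JL_norm p (f + g) <= JL_norm p f + JL_norm p g.
Proof.
move=> /JL_predP[cf Nf] /JL_predP[cg Ng].
have sD := sup_normD cf cg.
rewrite /JL_norm; case: p p1 Nf Ng => [r| |] //; rewrite lte_fin => r1 Nf Ng.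
rewrite ge_max; apply/andP; split.
  by apply: (le_trans sD); apply: lerD; rewrite le_max lexx.
have fin h : (ell_norm r h < +oo)%E -> ell_norm r h \is a fin_num.
  by move=> hy; rewrite ge0_fin_numE ?ell_norm_ge0.
have H := ell_normD f g (ltW r1).
apply: (@le_trans _ _ (fine (ell_norm r f + ell_norm r g)%E)).
  apply: fine_le => //; last by rewrite fin_numD !fin.
  by apply: fin; apply: le_lt_trans H _; exact: lte_add_pinfty.
rewrite fineD ?fin //.
by apply: lerD; rewrite le_max lexx orbT.
Qed.

Fact JL_norm_scale (a : R) f : f \in JL_pred p ->
  JL_norm p (a *: f) = `|a| * JL_norm p f.
Proof.
move=> /JL_predP[cf Nf].
have sZ := sup_normZ a cf.
rewrite /JL_norm; case: p p1 Nf => [r| |] //; rewrite lte_fin => r1 Nf.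
rewrite maxr_pMr //; congr Num.max; first exact: sZ.
rewrite (ell_normZ _ _ (lt_trans ltr01 r1)) fineM //.
by rewrite ge0_fin_numE ?ell_norm_ge0.
Qed.

Fact JL_norm_zero f : f \in JL_pred p -> JL_norm p f = 0 -> f = 0.
Proof.
move=> /JL_predP[cf _] H.
have s0 : sup_norm f <= 0.
  by rewrite -H /JL_norm; case: p => [r| |] //; rewrite le_max lexx.
apply/funext => x; apply/eqP; rewrite -normr_le0.
exact: le_trans (sup_norm_ge x cf) s0.
Qed.

HB.instance Definition _ := GRing.isSubmodClosed.Build _ _ (JL_pred p)
  JL_submod_closed.

HB.instance Definition _ := [isSub for @JL_fun p p1].
HB.instance Definition _ := [Choice of JL p1 by <:].
HB.instance Definition _ := [SubChoice_isSubLmodule of JL p1 by <:].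

Lemma JL_continuous (f : JL p1) : continuous f.
Proof. by have /JL_predP[] := valP f. Qed.

Fact JL_normD (f g : JL p1) : JL_norm p (f + g) <= JL_norm p f + JL_norm p g.
Proof. exact: JL_norm_leD (valP f) (valP g). Qed.

Fact JL_normZ (a : R) (f : JL p1) : JL_norm p (a *: f) = `|a| * JL_norm p f.
Proof. exact: JL_norm_scale (valP f). Qed.

Fact JL_norm_eq0 (f : JL p1) : JL_norm p f = 0 -> f = 0.
Proof. by move=> f0; apply/val_inj; exact: JL_norm_zero (valP f) f0. Qed.

HB.instance Definition _ := Lmodule_isNormed.Build R (JL p1)
  JL_normD JL_normZ JL_norm_eq0.

End JL_space.

End JohnsonLindenstrauss.

Definition isomorphic (R : numFieldType) (V W : normedModType R) : Prop :=
  exists (T : {linear V -> W}) (S : W -> V),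
    [/\ cancel T S, cancel S T, continuous T & continuous S].

(* seq 'I_m is the full m-adic tree; mkseq x n is the restriction of x to n. *)
Definition branch (m : nat) (x : nat -> 'I_m) : set (seq 'I_m) :=
  range (mkseq x).

Definition branches (m : nat) : set (set (seq 'I_m)) := range (@branch m).
Arguments branches m : clear implicits.

Lemma branches_almost_disjoint (m : nat) : almost_disjoint (branches m).
Proof.
split=> [_ [x _ <-]|_ _ [x _ <-] [y _ <-] xy].
  move=> fin; apply: infinite_nat.
  apply: sub_finite_set (finite_image size fin) => n _.
  by exists (mkseq x n); [exists n|rewrite size_mkseq].
have [k xyk] : exists k, x k <> y k.
  by apply/existsNP => xyE; apply: xy; congr branch; exact/funext.
apply: sub_finite_set (finite_image (mkseq x) (finite_II k.+1)).
move=> _ [[n _ <-] [n' _ E]]; exists n => //=.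
have nn' : n' = n by rewrite -(size_mkseq y n') E size_mkseq.
rewrite {}nn' in E; rewrite ltnS leqNgt; apply/negP => kn; apply: xyk.
by rewrite -(nth_mkseq (x 0%N) x kn) -E nth_mkseq.
Qed.

(* Main.v *)
(* Write m = k + 2. The words 0, 10, ..., 1^k 0, 1^(k+1) form a complete prefix
   code, so concatenating them sends the nodes of the m-adic tree to a set P of
   nodes of the binary tree ("codes") and identifies the branches of the two
   trees. Let u be the difference of a function on the compactification of the
   binary tree from its value at infinity. Subtracting from u t, for each node
   t outside P, the sum of u over the finitely many minimal codes extending t
   is invertible, keeps the values on branches, and leaves outside P only
   coordinates that tend to 0: a branch through t meets exactly one of these
   minimal codes, and the others are almost disjoint from every branch. What
   remains is a function for the m-adic tree together with countably many c_0
   coordinates, which are absorbed by an infinite antichain of the m-adic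
   tree. *)
Require Import Defs.
From HB Require Import structures.
From mathcomp Require Import all_boot all_order all_algebra finmap.
From mathcomp Require Import all_classical all_reals all_analysis.
From mathcomp Require Import ring lra.

Set Implicit Arguments.
Unset Strict Implicit.
Unset Printing Implicit Defensive.

Import Order.TTheory GRing.Theory Num.Theory.
Import numFieldNormedType.Exports.

Local Open Scope classical_set_scope.
Local Open Scope ring_scope.

(** * Continuity on the compactification *)

(** If [E] were infinite, the sets containing all but finitely many points of [E] would form a
    proper filter containing [K]. At a cluster point [x] with neighbourhood [U], the set [E] minus
    [U] lies in the filter yet misses [U]. *)
Lemma compact_locally_finite (T : topologicalType) (K E : set T) :
  compact K -> E `<=` K ->
  (forall x : T, exists2 U, nbhs x U & finite_set (E `&` U)) -> finite_set E.
Proof.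
move=> cK EK fU; apply: contrapT => iE.
have pF : ProperFilter [set U | finite_set (E `\` U)].
  apply: Build_ProperFilter => /=; first by rewrite setD0.
  split => /=; first by rewrite setDT; exact: finite_set0.
    by move=> P Q fP fQ; rewrite /= setDIr finite_setU.
  move=> P Q PQ; apply: sub_finite_set; exact: setDS.
have [|x [_ clx]] := cK _ pF.
  rewrite /=; suff -> : E `\` K = set0 by exact: finite_set0.
  by apply/seteqP; split => // y [/EK].
have [U nU EU] := fU x.
have [|y [[Ey nEUy] Uy]] := clx (E `\` (E `&` U)) U _ nU.
  by apply: sub_finite_set EU => y [Ey /not_andP[]// /contrapT].
exact: nEUy.
Qed.

Section C0.
Variable R : realType.

Definition c0_on (T : Type) (D : set T) (u : T -> R) :=
  forall e : R, 0 < e -> finite_set (D `&` [set x | e <= `|u x|]).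

Lemma c0_onS T (D D' : set T) u : D' `<=` D -> c0_on D u -> c0_on D' u.
Proof. by move=> DD uD e /uD; apply: sub_finite_set; exact: setSI. Qed.

Lemma c0_onU T (D D' : set T) u : c0_on D u -> c0_on D' u -> c0_on (D `|` D') u.
Proof. by move=> uD uD' e e0; rewrite setIUl finite_setU; split; auto. Qed.

Lemma finite_c0_on T (D : set T) u : finite_set D -> c0_on D u.
Proof. by move=> fD e _; exact: finite_setIl. Qed.

Lemma eq_c0_on T (D : set T) u w : (forall x, D x -> u x = w x) -> c0_on D u -> c0_on D w.
Proof.
by move=> uw uD e /uD; apply: sub_finite_set => x [Dx]; rewrite /= -uw.
Qed.

Lemma c0_onD T (D : set T) u w :
  c0_on D u -> c0_on D w -> c0_on D (fun x => u x + w x).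
Proof.
move=> uD wD e e0; have e20 : 0 < e / 2 by lra.
have := uD _ e20; have := wD _ e20 => fw fu.
apply: (@sub_finite_set _ _ (D `&` [set x | e / 2 <= `|u x|] `|`
                             D `&` [set x | e / 2 <= `|w x|])).
  move=> x [Dx /= le_e]; have := ler_normD (u x) (w x).
  by have [?|?] := lerP (e / 2) `|u x|; [left|right; split => //=; lra].
by rewrite finite_setU.
Qed.

Lemma c0_onN T (D : set T) u : c0_on D u -> c0_on D (fun x => - u x).
Proof.
by move=> uD e /uD; apply: sub_finite_set => x [Dx]; rewrite /= normrN.
Qed.

Lemma c0_onB T (D : set T) u w :
  c0_on D u -> c0_on D w -> c0_on D (fun x => u x - w x).
Proof. by move=> uD /c0_onN; exact: c0_onD. Qed.

Lemma c0_on_comp T T' (g : T' -> T) (D : set T) u : injective g ->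
  c0_on D u -> c0_on (g @^-1` D) (u \o g).
Proof.
move=> ig uD e /uD; apply: (@finite_preimage _ _ _ g).
by move=> x y _ _ /ig.
Qed.

(* Continuity of a function on the compactification, read off its differences
   from the value at infinity: u on the nodes and v on the family. *)
Record JL_data (N I : Type) (A : I -> set N) (u : N -> R) (v : I -> R) : Prop := {
  JL_data_on : forall i, c0_on (A i) (fun n => u n - v i);
  JL_data_c0 : c0_on [set: I] v;
  JL_data_perp : forall D, (forall i, finite_set (D `&` A i)) -> c0_on D u }.

Section Continuity.
Variables (N : countType) (AA : set (set N)) (f : K_space AA -> R).

Let u (n : N) : R := f (Some (inl n)) - f None.
Let v (A : AA) : R := f (K_set A) - f None.

Lemma nbhs_K_setP (A : AA) (U : set (K_space AA)) :
  nbhs (K_set A) U <-> exists2 F, finite_set F &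
    U (K_set A) /\ forall n, val A n -> ~ F n -> U (Some (inl n)).
Proof.
split.
  case=> F fF FU; exists F => //; split; first by apply: FU; left.
  by move=> n An nFn; apply: FU; right; exists n.
by case=> F fF [UA UF]; exists F => // _ [->|[n [An nFn] <-]] //; exact: UF.
Qed.

(** Both c_0 fields come from compactness: the points where [f] stays [e] away from its value at
    infinity are locally finite. Nodes are isolated, a basic neighbourhood of [A] contains no other
    point of the family and finitely many nodes of [D], and some neighbourhood of infinity misses
    them all. *)
Lemma continuous_JL_data : continuous f -> JL_data (fun A : AA => val A) u v.
Proof.
move=> cf.
have near_f x e : 0 < e -> nbhs x [set y | `|f y - f x| < e].
  move=> e0; have /cvgr_dist_lt/(_ e e0) := cf x.
  by apply: filterS => y /=; rewrite distrC.
have cK : compact [set: K_space AA] by exact: one_point_compactification_compact.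
have far e : 0 < e ->
    nbhs (None : K_space AA) [set y | ~ e <= `|f y - f None|].
  move=> e0; apply: filterS (near_f None e e0) => y /= lt_e.
  by rewrite leNgt lt_e.
split.
- move=> A e e0; have /nbhs_K_setP[F fF [_ AF]] := near_f (K_set A) e e0.
  apply: sub_finite_set fF => n [An /=]; apply: contraPP => nFn.
  by have /= := AF n An nFn; rewrite /u /v => H; rewrite leNgt opprB addrA subrK H.
- move=> e e0; pose E := (@K_set N AA) @` [set A | e <= `|v A|].
  suff : finite_set E.
    move=> fE; rewrite setTI; apply: sub_finite_set (finite_preimage _ fE).
      by move=> A vA; exists A.
    by move=> A B _ _ [].
  apply: (compact_locally_finite cK) => // -[[n|A]|].
  + exists [set Some (inl n)]; first by [].
    by apply/sub_finite_set/finite_set0 => _ [[A _ <-]].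
  + exists (~` [set x | exists B, B <> A /\ x = K_set B]); last first.
      apply/sub_finite_set/(finite_set1 (K_set A)) => _ [[B _ <-] nB].
      by have [->//|BA] := pselect (B = A); case: nB; exists B.
    apply/nbhs_K_setP; exists set0 => //.
    by split=> [[B [BA [AB]]]|n _ _ [B []//]]; exact: BA.
  + exists [set y | ~ e <= `|f y - f None|]; first exact: far.
    by apply/sub_finite_set/finite_set0 => _ [[A /= vA <-] []].
- move=> D fD e e0.
  pose E := (fun n => Some (inl n) : K_space AA) @` (D `&` [set n | e <= `|u n|]).
  suff : finite_set E.
    move=> fE; apply: sub_finite_set (finite_preimage _ fE).
      by move=> n vn; exists n.
    by move=> n k _ _ [].
  apply: (compact_locally_finite cK) => // -[[n|A]|].
  + exists [set Some (inl n)]; first by [].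
    exact/finite_setIr/finite_set1.
  + exists ([set K_set A] `|` (fun n => Some (inl n)) @` val A).
      by apply/nbhs_K_setP; exists set0 => //; split=> [|n An _]; [left|right; exists n].
    apply/sub_finite_set/(finite_image (fun n => Some (inl n)) (fD A)).
    move=> _ [[n [Dn _] <-] [//|[k Ak [kn]]]]; exists n => //; split => //.
    by rewrite -kn.
  + exists [set y | ~ e <= `|f y - f None|]; first exact: far.
    by apply/sub_finite_set/finite_set0 => _ [[n [_ /= vn] <-] []].
Qed.

Lemma JL_data_continuous : JL_data (fun A : AA => val A) u v -> continuous f.
Proof.
case=> uA v0 uD.
have cS (x : psi AA) (e : R) : 0 < e ->
    nbhs (Some x : K_space AA) [set y | `|f (Some x) - f y| < e].
  move=> e0; case: x => [n|A]; first by rewrite /nbhs /= /nbhs /= subrr normr0.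
  apply/nbhs_K_setP; exists (val A `&` [set n | e <= `|u n - v A|]); first exact: uA.
  rewrite /= subrr normr0; split=> // n An /not_andP[] // /negP; rewrite -ltNge.
  by rewrite /u /v opprB addrA subrK distrC.
move=> y; apply/(@cvgrPdist_lt _ _ _ (nbhs y)) => e e0; case: y => [x|]; first exact: cS.
have e20 : 0 < e / 2 by lra.
pose K := [set x : psi AA | e <= `|f None - f (Some x)|].
(* Neighbourhoods of infinity are given by closed compact sets, so it remains to show that [K] is
   one: it lies in finitely many compact cones together with a finite set of nodes. *)
exists K; last first.
  by move=> y [[x /= /negP + <-]|->] /=; [rewrite -ltNge|rewrite subrr normr0].
pose G := [set A : AA | e / 2 <= `|v A|].
have fG : finite_set G by have := v0 _ e20; rewrite setTI.
(* [S] misses every [A] in [G]; for the other [A], [u] is [e / 2] away from [v A] on [S], so [S]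
   meets [A] in a finite set. Hence [u] is c_0 on [S], which makes [S] finite. *)
pose S := [set n | e <= `|u n|] `\` \bigcup_(A in G) val A.
have fS : finite_set S.
  suff /uD/(_ e e0) : forall A : AA, finite_set (S `&` val A).
    by apply: sub_finite_set => n [].
  move=> A; have [GA|/negP] := pselect (G A).
    by apply/sub_finite_set/finite_set0 => n [[_ nG] An]; apply: nG; exists A.
  rewrite -ltNge => vA; apply: sub_finite_set (uA A _ e20) => n [[/= un _] An].
  by split => //=; have := lerB_dist (u n) (v A); lra.
pose cone (A : AA) : set (psi AA) := [set inr A] `|` inl @` val A.
(* A neighbourhood of the point [A] leaves out only finitely many nodes of the cone. *)
have cc A : compact (cone A).
  apply/compact_near_coveringP => I F P FF coverP.
  have [[U i] [/= nU Fi] UP] := coverP (inr A) (or_introl erefl).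
  have [H fH HU] : psi_nbhs (inr A) U := nU.
  have FW : \near F, inl @` (val A `&` H) `<=` P F.
    have /compact_near_coveringP cH : compact ((inl : N -> psi AA) @` (val A `&` H)).
      exact/finite_compact/finite_image/finite_setIr.
    apply: cH => //.
    by move=> _ [n [An _] <-]; apply: coverP; right; exists n.
  apply: filterS (filterI Fi FW) => j [ij Wj] _ [->|[n An <-]].
    by apply: (UP (_, _)); split => //; apply: HU; left.
  have [Hn|nHn] := pselect (H n); first by apply: Wj; exists n.
  by apply: (UP (_, _)); split => //; apply: HU; right; exists n.
have cSome : continuous (fun x : psi AA => f (Some x)).
  by move=> x; apply/(@cvgrPdist_lt _ _ _ (nbhs x)) => d d0; exact: (cS x d d0).
have clK : closed K.
  have -> : K = (fun x : psi AA => f (Some x)) @^-1` [set z | e <= `|f None - z|] by [].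
  apply: preimage_closed => //.
  have -> : [set z | e <= `|f None - z|] = ~` (ball (f None) e).
    by apply/seteqP; split=> z; rewrite /ball /= leNgt => /negP.
  exact/open_closedC/ball_open.
split => //.
pose B : set (psi AA) := \big[setU/set0]_(A <- fset_set G) cone A `|` inl @` S.
have cB : compact B.
  apply: compactU; first exact: bigsetU_compact.
  exact/finite_compact/finite_image.
refine (subclosed_compact clK cB _).
rewrite /B bigsetU_fset_set // => x Kx.
case: x Kx => [n|A] Kx.
  have un : e <= `|u n| by rewrite /u distrC.
  have [[A GA An]|nG] := pselect ((\bigcup_(A in G) val A) n); last by right; exists n.
  by left; exists A => //; right; exists n.
left; exists A; last by left.
by rewrite /G /= /v distrC; move: Kx; rewrite /K /=; lra.
Qed.

End Continuity.
End C0.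

(** * Operators between Johnson-Lindenstrauss spaces *)

Section Operator.
Variables (R : realType) (N M : countType) (AA : set (set N)) (BB : set (set M)).

(** Values on the family are only reindexed, which preserves the p-seminorm; [t] acts on differences
    from the value at infinity, the form in which [JL_data] expresses continuity. *)
Definition JL_op (th : BB -> AA) (t : (N -> R) -> M -> R)
    (f : K_space AA -> R) (x : K_space BB) : R :=
  match x with
  | None => f None
  | Some (inr B) => f (K_set (th B))
  | Some (inl n) => f None + t (fun k => f (Some (inl k)) - f None) n
  end.

Definition linear_op (t : (N -> R) -> M -> R) :=
  forall a u w, t (a *: u + w) = a *: t u + t w.

Definition bounded_op (t : (N -> R) -> M -> R) (C : R) :=
  forall c u, (forall n, `|u n| <= c) -> forall n, `|t u n| <= C * c.

Variables (p : \bar R) (p1 : (1 < p)%E) (th : BB -> AA) (t : (N -> R) -> M -> R).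
Variable C : R.
Hypotheses (th_bij : bijective th) (t_lin : linear_op t) (t_bnd : bounded_op t C).
Hypothesis t_data : forall u v, JL_data (fun A : AA => val A) u v ->
  JL_data (fun B : BB => val B) (t u) (v \o th).

Lemma JL_op_continuous f : continuous f -> continuous (JL_op th t f).
Proof.
move=> /continuous_JL_data/t_data H; apply: JL_data_continuous.
by congr JL_data: H; apply/funext => n /=; rewrite addrAC subrr add0r.
Qed.

Lemma JL_op_ell_norm r f : ell_norm r (JL_op th t f) = ell_norm r f.
Proof.
congr poweR; rewrite [RHS](reindex_esum [set: BB] [set: AA] th) //.
case: th_bij => th' thK th'K; split=> //; first by move=> x y _ _ /(can_inj thK).
by move=> A _; exists (th' A).
Qed.

(** Differences from the value at infinity are bounded by twice the norm, whence the factor 2; the 1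
    accounts for the value at infinity added back. *)
Lemma JL_op_sup_norm f : continuous f ->
  sup_norm (JL_op th t f) <= (1 + 2 * `|C|) * sup_norm f.
Proof.
move=> cf; have s0 := sup_norm_ge0 cf; have sf x := sup_norm_ge x cf.
have Cs : 0 <= `|C| * sup_norm f by exact: mulr_ge0.
apply: sup_norm_le => -[[n|B]|] /=.
- apply: le_trans (ler_normD _ _) _; rewrite mulrDl mul1r; apply: lerD => //.
  apply: le_trans (t_bnd (c := 2 * sup_norm f) _ n) _.
    move=> k; apply: le_trans (ler_normB _ _) _.
    by have := sf (Some (inl k)); have := sf None; lra.
  have := ler_norm C; rewrite mulrA [_ * 2]mulrC => CC.
  by apply: ler_wpM2r => //; apply: ler_wpM2l.
- by have := sf (K_set (th B)); lra.
- by have := sf None; lra.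
Qed.

Lemma JL_op_pred f : f \in JL_pred p -> JL_op th t f \in JL_pred p.
Proof.
move=> /JL_predP[cf Nf]; apply/JL_predP; split; first exact: JL_op_continuous.
by case: p Nf => [r| |] //; rewrite JL_op_ell_norm.
Qed.

Lemma JL_op_norm f : f \in JL_pred p ->
  JL_norm p (JL_op th t f) <= (1 + 2 * `|C|) * JL_norm p f.
Proof.
move=> /JL_predP[cf _]; have bf := JL_op_sup_norm cf.
rewrite /JL_norm; case: p => [r| |] //; rewrite JL_op_ell_norm.
have C1 : 1 <= 1 + 2 * `|C| by have := normr_ge0 C; lra.
have C0 : 0 <= 1 + 2 * `|C| by lra.
rewrite ge_max; apply/andP; split.
  by apply: le_trans bf _; apply: ler_wpM2l => //; rewrite le_max lexx.
apply: (@le_trans _ _ (Num.max (sup_norm f) (fine (ell_norm r f)))).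
  by rewrite le_max lexx orbT.
by apply: ler_peMl => //; rewrite le_max sup_norm_ge0.
Qed.

Lemma JL_op_linear a f g : JL_op th t (a *: f + g) = a *: JL_op th t f + JL_op th t g.
Proof.
apply/funext => -[[n|B]|] //=.
have -> : (fun k => (a *: f + g) (Some (inl k)) - (a *: f + g) None) =
  a *: (fun k => f (Some (inl k)) - f None) + (fun k => g (Some (inl k)) - g None).
  by apply/funext => k; rewrite /= !fctE /=; rewrite /GRing.scale /=; ring.
by rewrite t_lin !fctE /= /GRing.scale /=; ring.
Qed.

Lemma JL_op_bounded_linear : exists T : {linear JL AA p1 -> JL BB p1},
  continuous T /\ forall f, T f = JL_op th t f :> (K_space BB -> R).
Proof.
pose T0 (f : JL AA p1) : JL BB p1 := MkJL p1 (JL_op_pred (valP f)).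
have T0_lin : linear T0.
  by move=> a f g; apply/val_inj; rewrite /= JL_op_linear.
pose T : {linear JL AA p1 -> JL BB p1} :=
  HB.pack T0 (GRing.isLinear.Build _ _ _ _ T0 T0_lin).
exists T; split=> //.
apply: bounded_linear_continuous.
apply/linear_boundedP; near=> r => f.
apply: (@le_trans _ _ ((1 + 2 * `|C|) * `|f|)); first exact: JL_op_norm (valP f).
by apply: ler_wpM2r => //; near: r; exact: nbhs_pinfty_ge.
Unshelve. all: by end_near. Qed.

End Operator.

Lemma JL_op_can (R : realType) (N M : countType) (AA : set (set N))
    (BB : set (set M)) (th : BB -> AA) (th' : AA -> BB)
    (t : (N -> R) -> M -> R) (t' : (M -> R) -> N -> R) :
  cancel th' th -> cancel t t' -> cancel (JL_op th t) (JL_op th' t').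
Proof.
move=> thK tK f; apply/funext => -[[n|B]|] //=; last by rewrite /K_set thK.
rewrite -[in RHS](subrK (f None) (f (Some (inl n)))) addrC; congr (_ + _).
rewrite -[RHS](congr1 (@^~ n) (tK (fun k => f (Some (inl k)) - f None))).
by congr (t' _ n); apply/funext => k; rewrite addrAC subrr add0r.
Qed.

(** The conditions on the operators do not mention [p], so one pair of operators serves every
    exponent. *)
Lemma JL_isomorphic (R : realType) (p : \bar R) (p1 : (1 < p)%E)
    (N M : countType) (AA : set (set N)) (BB : set (set M))
    (th : BB -> AA) (th' : AA -> BB)
    (t : (N -> R) -> M -> R) (t' : (M -> R) -> N -> R) (C C' : R) :
  cancel th th' -> cancel th' th -> cancel t t' -> cancel t' t ->
  linear_op t -> linear_op t' -> bounded_op t C -> bounded_op t' C' ->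
  (forall u v, JL_data (fun A : AA => val A) u v ->
    JL_data (fun B : BB => val B) (t u) (v \o th)) ->
  (forall u v, JL_data (fun B : BB => val B) u v ->
    JL_data (fun A : AA => val A) (t' u) (v \o th')) ->
  isomorphic (JL AA p1) (JL BB p1).
Proof.
move=> thK th'K tK t'K tl t'l tb t'b td t'd.
have [T [cT TE]] := JL_op_bounded_linear p1 (Bijective thK th'K) tl tb td.
have [S [cS SE]] := JL_op_bounded_linear p1 (Bijective th'K thK) t'l t'b t'd.
by exists T, S; split=> // f; apply/val_inj; rewrite /= ?(TE, SE) JL_op_can.
Qed.

(** Finite changes of the sets are harmless. For the last field, the preimage of [A (th j)] exceeds
    [B j] by a finite set, so a set almost disjoint from all [B j] has image almost disjoint from
    all [A i]. *)
Lemma JL_data_transport (R : realType) (N M I J : Type) (A : I -> set N)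
    (B : J -> set M) (e : M -> N) (th : J -> I) (u : N -> R) (v : I -> R) :
  injective e -> bijective th ->
  (forall j, finite_set (B j `\` e @^-1` A (th j))) ->
  (forall j, finite_set (e @^-1` A (th j) `\` B j)) ->
  JL_data A u v -> JL_data B (u \o e) (v \o th).
Proof.
move=> ie [th' thK th'K] BA AB [uA v0 uP]; split.
- move=> j; rewrite -(setUIDK (B j) (e @^-1` A (th j))); apply: c0_onU.
    apply: (c0_onS (@subIsetr _ _ _)).
    exact: (c0_on_comp ie (uA (th j))).
  exact: finite_c0_on.
- exact: (c0_on_comp (can_inj thK) v0).
- move=> D fD; suff /uP : forall i, finite_set ((e @` D) `&` A i).
    move=> /(c0_on_comp ie); apply: c0_onS => x Dx; by exists x.
  move=> i; rewrite -(th'K i); set j := th' i.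
  apply: (@sub_finite_set _ _ (e @` (D `&` B j `|` (e @^-1` A (th j) `\` B j)))).
    move=> _ [[x Dx <-] Ax]; exists x => //.
    by have [Bx|nBx] := pselect (B j x); [left|right].
  by apply: finite_image; rewrite finite_setU.
Qed.

(** * Splitting off c_0 coordinates *)

Section Expansion.
Variables (R : realType) (N : eqType) (I : Type) (A : I -> set N).
Variables (P : set N) (L : N -> seq N) (C : nat).
Implicit Types (u : N -> R) (v : I -> R).

(** In the application [A] runs over the binary branches, [P] is the set of codes and [L t] lists
    the minimal codes extending a node [t] outside [P]. *)
Definition seq_sum u (t : N) : R := \sum_(p <- L t) u p.

Hypothesis A_ad : forall i j, i <> j -> finite_set (A i `&` A j).
Hypothesis L_nil : forall t, P t -> L t = [::].
Hypothesis L_sub : forall t p, p \in L t -> P p.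
Hypothesis L_size : forall t, (size (L t) <= C)%N.
Hypothesis L_fin : forall p, finite_set [set t | p \in L t].
Hypothesis L_down : forall i t p, p \in L t -> A i p -> A i t.
Hypothesis L_uniq : forall t, uniq (L t).
Hypothesis L_one : forall i t, A i t -> ~ P t ->
  exists p, [/\ p \in L t, A i p & forall q, q \in L t -> A i q -> q = p].

Lemma seq_sum_bounded (c : R) u t :
  (forall p, p \in L t -> `|u p| <= c) -> `|seq_sum u t| <= (size (L t))%:R * c.
Proof.
rewrite /seq_sum; elim: (L t) => [|p s IH] us; first by rewrite big_nil normr0 mul0r.
rewrite big_cons; apply: le_trans (ler_normD _ _) _.
rewrite /= -natr1 mulrDl mul1r addrC; apply: lerD.
  by apply: IH => q qs; apply: us; rewrite inE qs orbT.
by apply: us; rewrite inE eqxx.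
Qed.

(** At most [C] terms of size at most [e / C.+1] sum to less than [e], so a large sum has a large
    term; there are finitely many large terms, each in finitely many lists. *)
Lemma seq_sum_c0 (X D : set N) u : c0_on X u ->
  (forall t p, D t -> p \in L t -> X p) -> c0_on D (seq_sum u).
Proof.
move=> uX DX e e0; pose d := e / (C.+1)%:R.
have d0 : 0 < d by rewrite divr_gt0.
apply: sub_finite_set (bigcup_finite (uX d d0) (fun p _ => L_fin p)).
move=> t [Dt /= et]; apply: contrapT => nt.
suff : `|seq_sum u t| < e by rewrite ltNge et.
apply: le_lt_trans (seq_sum_bounded (c := d) _) _.
  move=> p pt; rewrite leNgt; apply/negP => dp; apply: nt; exists p => //.
  by split; [exact: DX pt|exact: ltW].
apply: (@le_lt_trans _ _ (C%:R * d)); first by rewrite ler_wpM2r ?(ltW d0) // ler_nat.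
by rewrite /d mulrCA gtr_pMr // ltr_pdivrMr // mul1r ltr_nat.
Qed.

Section Data.
Variables (u : N -> R) (v : I -> R).
Hypothesis u_on : forall i, c0_on (A i `&` P) (fun n => u n - v i).
Hypothesis u_perp : forall X, X `<=` P -> (forall i, finite_set (X `&` A i)) ->
  c0_on X u.

(** By [L_down], a point of [A i] listed by some [t] in [D] forces [t] into the finite set of points
    of [D] in [A i]; so the listed points are again almost disjoint from the family. *)
Lemma seq_sum_perp D : (forall i, finite_set (D `&` A i)) -> c0_on D (seq_sum u).
Proof.
move=> fD; pose X := \bigcup_(t in D) [set` L t].
apply: (@seq_sum_c0 X); last by move=> t p Dt pt; exists t.
apply: u_perp => [p [t _] /L_sub //|i].
apply: sub_finite_set (bigcup_finite (fD i) (fun t _ => finite_seq (L t))).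
by move=> p [[t Dt pt] Ap]; exists t => //; split => //; exact: L_down pt Ap.
Qed.

Lemma seq_sum_on i : c0_on (A i `\` P) (fun t => seq_sum u t - v i).
Proof.
(* For [t] in [A i] outside [P] exactly one point of [L t] lies in [A i], so summing [w] gives
   [seq_sum u t - v i]. The listed points off [A i] are almost disjoint from every [A j], by
   [L_down] and [A_ad], so [w] is c_0 on all listed points. *)
pose w p := if p \in A i then u p - v i else u p.
pose X := \bigcup_(t in A i) [set` L t].
have wX : c0_on X w.
  rewrite -(setUIDK X (A i)); apply: c0_onU.
    apply: (@eq_c0_on _ _ _ (fun n => u n - v i)).
      by move=> p [_ Ap]; rewrite /w mem_set.
    apply: c0_onS (u_on i) => p [[t _ /L_sub Pp] Ap]; by split.
  apply: (@eq_c0_on _ _ _ u); first by move=> p [_ nAp]; rewrite /w memNset.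
  apply: u_perp => [p [[t _] /L_sub //]|j].
  have [<-|ij] := pselect (i = j).
    by apply/sub_finite_set/finite_set0 => p [[_ nAp] /nAp].
  apply: sub_finite_set (bigcup_finite (A_ad ij) (fun t _ => finite_seq (L t))).
  by move=> p [[[t At pt] _] Ap]; exists t => //; split => //; exact: L_down pt Ap.
apply: (@eq_c0_on _ _ _ (seq_sum w)); last first.
  by apply: seq_sum_c0 wX _ => t p [At _] pt; exists t.
move=> t [At nPt]; have [p [pt Ap p_uniq]] := L_one At nPt.
rewrite /seq_sum (bigD1_seq p) //= [in RHS](bigD1_seq p) //= /w mem_set // addrAC.
congr (_ + _ - _); rewrite big_seq_cond [RHS]big_seq_cond.
apply: eq_bigr => q /andP[qt qp]; rewrite memNset // => /(p_uniq _ qt) /eqP.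
exact/negP.
Qed.

End Data.

Lemma JL_data_expand u v : JL_data A u v ->
  JL_data (fun i => A i `&` P) (fun t => u t - seq_sum u t) v.
Proof.
move=> [uA v0 uP].
have u_on i : c0_on (A i `&` P) (fun n => u n - v i).
  exact: c0_onS (@subIsetl _ _ _) (uA i).
have u_perp X : X `<=` P -> (forall i, finite_set (X `&` A i)) -> c0_on X u.
  by move=> _; exact: uP.
have sP t : P t -> seq_sum u t = 0 by move=> Pt; rewrite /seq_sum L_nil ?big_nil.
have outP : c0_on (~` P) (fun t => u t - seq_sum u t).
  (* Along [A i] outside [P] both terms tend to [v i], so [S] meets each [A i] in a finite set. Then
     both terms are c_0 on [S], where they differ by at least [e], and [S] is finite. *)
  move=> e e0; set S := _ `&` _.
  have fS i : finite_set (S `&` A i).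
    have : c0_on (A i `\` P) (fun t => u t - seq_sum u t).
      apply: (@eq_c0_on _ _ _ (fun t => (u t - v i) - (seq_sum u t - v i))).
        by move=> t _; ring.
      by apply: c0_onB (seq_sum_on u_on u_perp i); exact: c0_onS (@subDsetl _ _ _) (uA i).
    by move=> /(_ e e0); apply: sub_finite_set => t [[nPt et] At].
  have := c0_onB (uP S fS) (seq_sum_perp u_perp fS).
  by move=> /(_ e e0); apply: sub_finite_set => t [nPt et].
split=> //.
- move=> i; apply: eq_c0_on (u_on i) => t [_ Pt].
  by rewrite sP // subr0.
- move=> D fD; rewrite -(setUIDK D P); apply: c0_onU.
    apply: (@eq_c0_on _ _ _ u); first by move=> t [_ Pt]; rewrite sP // subr0.
    by apply: u_perp => // i; rewrite -setIA [P `&` _]setIC.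
  exact: c0_onS (@subDsetr _ _ _) outP.
Qed.

(** The complement of [P] is disjoint from every [A i] cut down to [P], so [u] is c_0 there; adding
    the sum restores the limit [v i] along the rest of [A i]. *)
Lemma JL_data_contract u v : JL_data (fun i => A i `&` P) u v ->
  JL_data A (fun t => u t + seq_sum u t) v.
Proof.
move=> [uA v0 uP].
have u_perp X : X `<=` P -> (forall i, finite_set (X `&` A i)) -> c0_on X u.
  move=> XP fX; apply: uP => i; apply: sub_finite_set (fX i).
  by move=> t [Xt [At _]].
have sP t : P t -> seq_sum u t = 0 by move=> Pt; rewrite /seq_sum L_nil ?big_nil.
have outP : c0_on (~` P) u.
  by apply: uP => i; apply/sub_finite_set/finite_set0 => t [nPt [_ /nPt]].
split=> //.
- move=> i; rewrite -(setUIDK (A i) P); apply: c0_onU.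
    by apply: eq_c0_on (uA i) => t [_ Pt]; rewrite sP // addr0.
  apply: (@eq_c0_on _ _ _ (fun t => u t + (seq_sum u t - v i))).
    by move=> t _; ring.
  apply: c0_onD (seq_sum_on uA u_perp i).
  exact: c0_onS (@subDsetr _ _ _) outP.
- move=> D fD; rewrite -(setUIDK D P); apply: c0_onU.
    apply: (@eq_c0_on _ _ _ u); first by move=> t [_ Pt]; rewrite sP // addr0.
    by apply: u_perp => // i; apply: sub_finite_set (fD i) => t [[Dt _] At].
  apply: c0_onD; first exact: c0_onS (@subDsetr _ _ _) outP.
  exact: c0_onS (@subIsetl _ _ _) (seq_sum_perp u_perp fD).
Qed.

End Expansion.

(** * Coding the m-adic tree in the binary tree *)

Section Branches.
Variable m : nat.
Implicit Types (s t : seq 'I_m) (A S : set (seq 'I_m)).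

Lemma branch_nil A : branches m A -> A [::].
Proof. by case=> x _ <-; exists 0%N. Qed.

Lemma branch_rcons A s : branches m A -> A s -> exists j, A (rcons s j).
Proof.
by case=> x _ <- [n _ <-]; exists (x n); exists n.+1 => //; rewrite mkseqS.
Qed.

Lemma branch_prefix A s t : branches m A -> A t -> prefix s t -> A s.
Proof.
case=> x _ <- [n _ <-] /prefixP[r nE]; exists (size s) => //.
have sn : (size s <= n)%N by rewrite -(size_mkseq x n) nE size_cat leq_addr.
apply: (@eq_from_nth _ (x 0%N)); rewrite size_mkseq // => i si.
by rewrite nth_mkseq // -(nth_mkseq (x 0%N) x (leq_trans si sn)) nE nth_cat si.
Qed.

Lemma branch_chain A s t : branches m A -> A s -> A t ->
  (size s <= size t)%N -> prefix s t.
Proof.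
case=> x _ <- [n _ <-] [n' _ <-]; rewrite !size_mkseq => nn'.
by rewrite -(subnKC nn') /mkseq iotaD map_cat prefix_prefix.
Qed.

Lemma branch_size A n : branches m A -> exists2 s, A s & size s = n.
Proof. by case=> x _ <-; exists (mkseq x n); [exists n|rewrite size_mkseq]. Qed.

(** Choosing successors inside [S] produces a branch contained in [S]; having one node per length,
    [S] contains nothing else. *)
Lemma branchesP S : S [::] -> (forall s, S s -> exists j, S (rcons s j)) ->
  (forall s t, S s -> S t -> size s = size t -> s = t) -> branches m S.
Proof.
move=> S0 S1 Su.
have [next nextP] : {f : seq 'I_m -> 'I_m & forall s, S s -> S (rcons s (f s))}.
  apply: (@choice _ _ (fun s j => S s -> S (rcons s j))) => s.
  have [/S1[j Sj]|nS] := pselect (S s); first by exists j.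
  (* Off [S] any letter will do; the root provides one. *)
  by have [j _] := S1 _ S0; exists j => /nS.
pose node n := iter n (fun s => rcons s (next s)) [::].
have nodeS n : S (node n) by elim: n => // n /nextP.
have nodeE n : mkseq (next \o node) n = node n.
  by elim: n => // n IH; rewrite mkseqS IH.
exists (next \o node) => //; apply/seteqP; split=> [_ [n _ <-]|s Ss].
  by rewrite nodeE.
exists (size s) => //; rewrite nodeE; apply: Su => //.
by rewrite -nodeE size_mkseq.
Qed.

End Branches.

Lemma prefix_nth (T : eqType) (x0 : T) (s t : seq T) n :
  prefix s t -> (n < size s)%N -> nth x0 s n = nth x0 t n.
Proof. by move=> /prefixP[r ->] ns; rewrite nth_cat ns. Qed.

Lemma prefix_size_eq (T : eqType) (s t : seq T) :
  prefix s t -> size s = size t -> s = t.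
Proof.
by rewrite prefixE => /eqP E st; rewrite -E st take_size.
Qed.

Lemma nseq_cat1 (T : Type) n (x : T) : nseq n x ++ [:: x] = nseq n.+1 x.
Proof. by elim: n => //= n ->. Qed.

Lemma finite_prefixes (T : eqType) (t : seq T) : finite_set [set s | prefix s t].
Proof.
apply: sub_finite_set (finite_image (take^~ t) (finite_II (size t).+1)) => s /= st.
exists (size s); first by rewrite /= ltnS size_prefix.
by apply/eqP; rewrite -prefixE.
Qed.

Lemma ord2_cases (x : 'I_2) : x = ord0 \/ x = ord_max.
Proof. by case: x => [[|[|//]] x2]; [left|right]; apply/val_inj. Qed.

Section Encode.
Variable k : nat.
Notation T := (seq 'I_k.+2).
Notation T2 := (seq 'I_2).
Implicit Types (s : T) (t : T2) (B : set T2) (A : set T).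

(* The words 0, 10, 110, ..., 1^k 0, 1^k.+1 form a complete prefix code, so
   concatenation of code words identifies the branches of the two trees. *)
Definition codeword (j : 'I_k.+2) : T2 :=
  nseq j ord_max ++ (if j == ord_max then [::] else [:: ord0]).

Definition encode s : T2 := flatten (map codeword s).

Lemma encode_rcons s j : encode (rcons s j) = encode s ++ codeword j.
Proof. by rewrite /encode map_rcons flatten_rcons. Qed.

Lemma size_code_gt0 j : (0 < size (codeword j))%N.
Proof.
rewrite /codeword size_cat size_nseq; have [->//|_] := eqVneq j ord_max.
by rewrite addn1.
Qed.

Lemma size_encode s : (size s <= size (encode s))%N.
Proof.
elim: s => // j s IH; rewrite /encode /= size_cat -add1n.
exact: leq_add (size_code_gt0 j) IH.
Qed.

Lemma nth_code (j : 'I_k.+2) n t : (n < j)%N -> nth ord0 (codeword j ++ t) n = ord_max.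
Proof. by move=> nj; rewrite /codeword -catA nth_cat size_nseq nj nth_nseq nj. Qed.

Lemma nth_code_last (j : 'I_k.+2) t : j != ord_max -> nth ord0 (codeword j ++ t) j = ord0.
Proof.
by move=> /negbTE jm; rewrite /codeword jm -catA nth_cat size_nseq ltnn subnn.
Qed.

(** If the letters differ, the word of the smaller one has 0 at the position given by that letter,
    where the other word still has 1. *)
Lemma prefix_code i j t t' : prefix (codeword i ++ t) (codeword j ++ t') -> i = j.
Proof.
move=> ij; apply/val_inj.
have last (n l : 'I_k.+2) : (n < l)%N -> n != ord_max.
  by apply: contraTneq => ->; rewrite -leqNgt -ltnS.
case: (ltngtP (val i) (val j)) => // lt_ij.
- have := prefix_nth ord0 ij (n := i).
  rewrite (@nth_code j) // nth_code_last ?(last _ j) //.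
  rewrite size_cat /codeword size_cat size_nseq (negbTE (last _ _ lt_ij)) addn1.
  by move=> /(_ (ltn_addr _ (ltnSn _)))/(congr1 val).
- have := prefix_nth ord0 ij (n := j).
  rewrite (@nth_code i) // nth_code_last ?(last _ i) //.
  rewrite size_cat /codeword size_cat size_nseq -addnA => /(_ (ltn_addr _ lt_ij)).
  by move=> /(congr1 val).
Qed.

Lemma prefix_encode s s' : prefix (encode s) (encode s') = prefix s s'.
Proof.
elim: s s' => [|i s IH] [|j s'] //; first by rewrite !prefix0s.
  rewrite [encode [::]]/(encode [::]) !prefixs0 -size_eq0.
  by case: (size (encode _)) (size_encode (i :: s)).
have encode_cons l r : encode (l :: r) = codeword l ++ encode r by [].
rewrite prefix_cons !encode_cons; have [<-|ij] /= := eqVneq i j.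
  by rewrite prefix_catr // eqxx IH.
apply/negP => /prefix_code ijE; by rewrite ijE eqxx in ij.
Qed.

Lemma encode_inj : injective encode.
Proof.
move=> s s' E; have ss' : prefix s s' by rewrite -prefix_encode E prefix_refl.
have s's : prefix s' s by rewrite -prefix_encode E prefix_refl.
apply: (prefix_size_eq ss'); apply/eqP.
by rewrite eqn_leq (size_prefix ss') (size_prefix s's).
Qed.

Lemma code_inord i : (i <= k)%N -> codeword (inord i) = nseq i ord_max ++ [:: ord0].
Proof.
move=> ik; have iE : (inord i : 'I_k.+2) = i :> nat by rewrite inordK // ltnS leqW.
by rewrite /codeword iE -val_eqE /= iE ltn_eqF.
Qed.

(** Greedy reading: after [i] pending ones, a 0 completes a code word, and a 1 either lengthens the
    run or, at [i = k], completes the word of [k.+1] ones. *)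
Lemma encode_parse t : exists si : T * nat,
  t = encode si.1 ++ nseq si.2 ord_max /\ (si.2 <= k)%N.
Proof.
elim/last_ind: t => [|t x [[s i] /= [tE ik]]]; first by exists ([::], 0%N).
have [->|->] := ord2_cases x.
  exists (rcons s (inord i), 0%N); split=> //=.
  by rewrite encode_rcons cats0 code_inord // tE -cats1 catA.
have [lt_ik|] := ltnP i k.
  exists (s, i.+1); split => //=; rewrite tE -cats1 -catA; by rewrite nseq_cat1.
move=> ki; exists (rcons s ord_max, 0%N); split => //=.
rewrite encode_rcons cats0 /codeword eqxx cats0 tE -cats1 -catA nseq_cat1.
by have -> : i = k by apply/eqP; rewrite eqn_leq ik.
Qed.

Lemma prefix_nseq_code (i : nat) (j : 'I_k.+2) t : (i <= j)%N ->
  prefix (t ++ nseq i ord_max) (t ++ codeword j).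
Proof.
move=> ij; rewrite prefix_catr // eqxx /codeword -(subnKC ij) nseqD -catA.
exact: prefix_prefix.
Qed.

(** Following [B] beyond the [i] ones, either a 0 appears and completes a code word, or the run
    reaches [k.+1] ones, again a code word. *)
Lemma branch_code B s i : branches 2 B -> B (encode s ++ nseq i ord_max) ->
  (i <= k)%N -> exists2 j : 'I_k.+2, (i <= j)%N & B (encode (rcons s j)).
Proof.
move=> brB; have step l : B (encode s ++ nseq l ord_max) -> (l <= k)%N ->
    (exists2 j : 'I_k.+2, (l <= j)%N & B (encode (rcons s j))) \/
    B (encode s ++ nseq l.+1 ord_max).
  move=> Bl lk; have [c] := branch_rcons brB Bl; rewrite -cats1 -catA.
  have [->|->] := ord2_cases c; last by rewrite nseq_cat1; right.
  move=> Bc; left; exists (inord l); first by rewrite inordK // ltnS leqW.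
  by rewrite encode_rcons code_inord.
have [n nE] : {n | n = (k - i)%N} by exists (k - i)%N.
elim: n i nE => [|n IH] i nE Bi ik; have [//|Bi1] := step _ Bi ik.
  have {nE ik}ik : i = k by apply/eqP; rewrite eqn_leq ik -subn_eq0 -nE.
  exists ord_max; first by rewrite ik ltnW.
  by rewrite encode_rcons /codeword eqxx cats0 -ik.
have [||j ij Bj] := IH i.+1 _ Bi1; first by rewrite subnS -nE.
  by rewrite -subn_gt0 -nE.
by exists j => //; exact: ltnW.
Qed.

Definition branch_closure A : set T2 := [set t | exists2 s, A s & prefix t (encode s)].

Lemma branches_preimage B : branches 2 B -> branches k.+2 (encode @^-1` B).
Proof.
move=> brB; apply: branchesP.
- exact: (branch_nil brB).
- move=> s Bs; have [|//|j _ Bj] := @branch_code B s 0 brB.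
    by rewrite cats0.
  by exists j.
(* Codes on [B] are comparable, hence so are their nodes, and comparable nodes of equal length
   coincide. *)
- have wlog_le s s' : B (encode s) -> B (encode s') ->
      (size (encode s) <= size (encode s'))%N -> size s = size s' -> s = s'.
    move=> Bs Bs' le_ss'; apply: prefix_size_eq; rewrite -prefix_encode.
    exact: (branch_chain brB).
  move=> s s' Bs Bs' ss'.
  case/orP: (leq_total (size (encode s)) (size (encode s'))) => le_ss'.
    exact: wlog_le.
  by symmetry; apply: wlog_le.
Qed.

Lemma branches_closure A : branches k.+2 A -> branches 2 (branch_closure A).
Proof.
move=> brA; apply: branchesP.
- by exists [::]; [exact: (branch_nil brA)|exact: prefix0s].
- move=> t [s As ts].
  (* This length makes [s'] extend [s], and makes its code, no shorter than [s'], strictly longer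
     than [t]. *)
  have [s' As' s'E] := branch_size (size s + (size t).+1) brA.
  have : prefix t (encode s').
    apply: prefix_trans ts _; rewrite prefix_encode.
    by apply: (branch_chain brA) => //; rewrite s'E leq_addr.
  move=> /prefixP[[|c r] tE].
    have := size_encode s'; rewrite tE cats0 s'E leqNgt.
    by rewrite addnS ltnS leq_addl.
  by exists c, s' => //; rewrite tE -cat_rcons prefix_prefix.
- move=> t t' [s As ts] [s' As' ts'] tt'.
  have [r tr t'r] : exists2 r, prefix t r & prefix t' r.
    case/orP: (leq_total (size s) (size s')) => le_ss'.
      exists (encode s') => //; apply: prefix_trans ts _.
      by rewrite prefix_encode; exact: (branch_chain brA).
    exists (encode s) => //; apply: prefix_trans ts' _.
    by rewrite prefix_encode; exact: (branch_chain brA).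
  by move: tr t'r; rewrite !prefixE => /eqP <- /eqP <-; rewrite tt'.
Qed.

Lemma preimage_closure A : branches k.+2 A -> encode @^-1` (branch_closure A) = A.
Proof.
move=> brA; apply/seteqP; split=> [s [s' As']|s As]; last first.
  by exists s => //; exact: prefix_refl.
by rewrite prefix_encode; exact: (branch_prefix brA).
Qed.

Lemma closure_preimage B : branches 2 B -> branch_closure (encode @^-1` B) = B.
Proof.
move=> brB; apply/seteqP; split=> [t [s Bs ts]|t Bt]; first exact: (branch_prefix brB) ts.
have [[s i] [/= tE ik]] := encode_parse t.
have [|j ij Bj] := @branch_code B s i brB _ ik; first by rewrite -tE.
by exists (rcons s j) => //; rewrite tE encode_rcons prefix_nseq_code.
Qed.

End Encode.

(** * Absorbing the nodes that are not codes *)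

(** The set [X] of points not reached from outside [D] contains the image of [D], so [D] and [X] are
    both countably infinite; [phi] is redefined on [D] by a bijection onto [X]. *)
Lemma extend_bijection (N M : countType) (phi : N -> M) (D : set N) :
  injective phi -> infinite_set D ->
  exists2 g : N -> M, bijective g & forall s, ~ D s -> g s = phi s.
Proof.
move=> phi_inj iD; pose X := ~` (phi @` (~` D)).
have iX : infinite_set X.
  move=> fX; apply: iD; have : finite_set (phi @^-1` X).
    by apply: finite_preimage fX => x y _ _ /phi_inj.
  apply: sub_finite_set => s Ds [s' nDs' /phi_inj ss'].
  by apply: nDs'; rewrite ss'.
have /card_set_bijP[a [_ a_inj a_surj]] := eq_card_nat (countableP D) iD.
have /card_set_bijP[c [_ c_inj c_surj]] := eq_card_nat (countableP X) iX.
have [b bP] : {b : nat -> M & forall n, X (b n) /\ c (b n) = n}.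
  apply: (@choice _ _ (fun n t => X t /\ c t = n)) => n.
  by have [t Xt ctn] := c_surj n I; exists t.
exists (fun s => if s \in D then b (a s) else phi s); last first.
  by move=> s nDs; rewrite memNset.
rewrite -setTT_bijective; split=> // [s s' _ _|t _].
- have [Ds|nDs] := pselect (D s); have [Ds'|nDs'] := pselect (D s').
  + rewrite !mem_set // => /(congr1 c); rewrite !(bP _).2.
    by apply: a_inj; exact: mem_set.
  + rewrite mem_set // memNset // => E; case: (bP (a s)).1.
    by exists s'.
  + rewrite memNset // mem_set // => E; case: (bP (a s')).1.
    by exists s.
  + by rewrite !memNset // => /phi_inj.
- have [Xt|/contrapT[s nDs st]] := pselect (X t); last first.
    by exists s => //=; rewrite memNset.
  have [s Ds as_] := a_surj (c t) I; exists s => //=; rewrite mem_set // as_.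
  by have [Xb cb] := bP (c t); apply: c_inj; rewrite ?inE.
Qed.

Section NextCodes.
Variable k : nat.
Notation T := (seq 'I_k.+2).
Notation T2 := (seq 'I_2).

(* An infinite antichain: by almost disjointness from all branches its nodes
   can absorb the nodes of the binary tree that are not codes. *)
Definition comb : set T := range (fun n => rcons (nseq n ord0) ord_max).

Lemma infinite_comb : infinite_set comb.
Proof.
move=> fin; apply: infinite_nat.
apply: sub_finite_set (finite_image (fun s => (size s).-1) fin) => n _.
by exists (rcons (nseq n ord0) ord_max); [exists n|rewrite size_rcons size_nseq].
Qed.

(** Distinct nodes of the comb are incomparable, since the shorter one ends in [ord_max] where the
    longer one has [ord0]; a branch therefore contains at most one. *)
Lemma finite_branch_comb A : branches k.+2 A -> finite_set (A `&` comb).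
Proof.
move=> brA; have sub n n' : A (rcons (nseq n ord0) ord_max) ->
    A (rcons (nseq n' ord0) ord_max) -> ~ (n < n')%N.
  move=> An An' nn'; have :
    prefix (rcons (nseq n ord0) ord_max) (rcons (nseq n' ord0) ord_max : T).
    by apply: (branch_chain brA) => //; rewrite !size_rcons !size_nseq ltnW.
  move=> /(@prefix_nth _ ord0 _ _ n); rewrite size_rcons size_nseq => /(_ (ltnSn _)).
  by rewrite !nth_rcons !size_nseq ltnn eqxx nn' nth_nseq nn' => /(congr1 val).
have [[d [Ad [n _ dE]]]|nA] := pselect ((A `&` comb) !=set0); last first.
  by apply/sub_finite_set/finite_set0 => s As; apply: nA; exists s.
apply: sub_finite_set (finite_set1 (rcons (nseq n ord0) ord_max)).
move=> d' [An' [n' _ dE']]; rewrite -dE in Ad; rewrite -dE' in An' *.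
case: (ltngtP n n') => [nn'|n'n|->] //; first by case: (sub _ _ Ad An').
by case: (sub _ _ An' Ad).
Qed.

Definition codes : set T2 := range (@encode k).

(* The minimal elements of codes extending t, for t outside codes. *)
Definition next_codes (t : T2) : seq T2 :=
  if t \in codes then [::] else
  let: (s, i) := sval (cid (encode_parse k t)) in
  [seq encode (rcons s j) | j : 'I_k.+2 <- enum 'I_k.+2 & (i <= j)%N].

Lemma next_codesP t p : p \in next_codes t -> [/\ codes p, prefix t p & ~ codes t].
Proof.
rewrite /next_codes; case: ifPn => // /negP nt; case: cid => -[s i] /= [tE ik].
move=> /mapP[j]; rewrite mem_filter => /andP[ij _] ->; split.
- by exists (rcons s j).
- by rewrite tE encode_rcons prefix_nseq_code.
- by move=> ct; apply: nt; rewrite inE.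
Qed.

Lemma size_next_codes t : (size (next_codes t) <= k.+2)%N.
Proof.
rewrite /next_codes; case: ifP => // _; case: cid => -[s i] /= _.
by rewrite size_map size_filter (leq_trans (count_size _ _)) // size_enum_ord.
Qed.

Lemma uniq_next_codes t : uniq (next_codes t).
Proof.
rewrite /next_codes; case: ifP => // _; case: cid => -[s i] /= _.
rewrite map_inj_uniq; first by rewrite filter_uniq // enum_uniq.
by move=> j j' /encode_inj /rcons_inj[].
Qed.

(** Two minimal codes on [B] are comparable and differ only in the last code word, so [prefix_code]
    identifies them. *)
Lemma branch_next_codes B t : branches 2 B -> B t -> ~ codes t ->
  exists p, [/\ p \in next_codes t, B p & forall q, q \in next_codes t -> B q -> q = p].
Proof.
move=> brB Bt nt; rewrite /next_codes memNset //; case: cid => -[s i] /= [tE ik].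
have [|j ij Bj] := branch_code (s := s) brB _ ik; first by rewrite -tE.
exists (encode (rcons s j)); split=> // [|q /mapP[l _ ->] Bl].
  by apply: map_f; rewrite mem_filter ij mem_enum.
rewrite !encode_rcons in Bj Bl *; suff -> : l = j by [].
have := leq_total (size (encode s ++ codeword l)) (size (encode s ++ codeword j)).
move=> /orP[] le_lj.
  have := branch_chain brB Bl Bj le_lj; rewrite prefix_catr // eqxx /=.
  by rewrite -[codeword l]cats0 -[codeword j]cats0 => /prefix_code.
have := branch_chain brB Bj Bl le_lj; rewrite prefix_catr // eqxx /=.
by rewrite -[codeword l]cats0 -[codeword j]cats0 => /prefix_code.
Qed.

End NextCodes.

(** * The operators between the two trees *)

Section Main.
Variables (R : realType) (k : nat).
Notation T := (seq 'I_k.+2).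
Notation T2 := (seq 'I_2).

Definition binary_branch (A : branches k.+2) : branches 2 :=
  exist _ (branch_closure (val A)) (mem_set (branches_closure (set_mem (valP A)))).

Definition adic_branch (B : branches 2) : branches k.+2 :=
  exist _ (@encode k @^-1` val B) (mem_set (branches_preimage k (set_mem (valP B)))).

Lemma binary_branchK : cancel binary_branch adic_branch.
Proof. by move=> A; apply/val_inj/preimage_closure/set_mem/valP. Qed.

Lemma adic_branchK : cancel adic_branch binary_branch.
Proof. by move=> B; apply/val_inj/closure_preimage/set_mem/valP. Qed.

Lemma next_codes_nil (t : T2) : codes k t -> next_codes k t = [::].
Proof. by rewrite /next_codes => /mem_set ->. Qed.

Lemma branches2_ad (A B : branches 2) : A <> B -> finite_set (val A `&` val B).
Proof.
move=> AB; apply: (branches_almost_disjoint 2).2; try exact/set_mem/valP.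
by move=> /val_inj.
Qed.

Lemma finite_next_codes p : finite_set [set t : T2 | p \in next_codes k t].
Proof.
by apply: sub_finite_set (finite_prefixes p) => t /next_codesP[].
Qed.

Lemma next_codes_branch (B : branches 2) t p :
  p \in next_codes k t -> val B p -> val B t.
Proof.
by move=> /next_codesP[_ tp _] Bp; exact: branch_prefix (set_mem (valP B)) Bp tp.
Qed.

Lemma next_codes_codes t p : p \in next_codes k t -> codes k p.
Proof. by case/next_codesP. Qed.

Lemma branch_next_codes_val (B : branches 2) t : val B t -> ~ codes k t ->
  exists p, [/\ p \in next_codes k t, val B p &
    forall q, q \in next_codes k t -> val B q -> q = p].
Proof. exact: branch_next_codes (set_mem (valP B)). Qed.

Notation sigma := (seq_sum (next_codes k)).

Lemma seq_sum_codes (u : T2 -> R) t : codes k t -> sigma u t = 0.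
Proof. by move=> ct; rewrite /seq_sum next_codes_nil ?big_nil. Qed.

Lemma seq_sum_sigma (u w : T2 -> R) t :
  (forall p, codes k p -> u p = w p) -> sigma u t = sigma w t.
Proof.
by move=> uw; apply: eq_big_seq => p /next_codes_codes /uw.
Qed.

Variable g : T -> T2.
Variable g' : T2 -> T.
Hypotheses (gK : cancel g g') (g'K : cancel g' g).
Hypothesis gE : forall s, ~ comb s -> g s = encode s.

Definition expand_op (u : T2 -> R) (s : T) : R := u (g s) - sigma u (g s).

Definition contract_op (w : T -> R) (t : T2) : R := w (g' t) + sigma (w \o g') t.

(** [sigma u] depends only on the values of [u] at codes and vanishes at codes, so [sigma] squares
    to zero: identity minus [sigma] and identity plus [sigma] are mutually inverse. *)
Lemma expand_opK : cancel expand_op contract_op.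
Proof.
move=> u; apply/funext => t; rewrite /contract_op /expand_op g'K.
rewrite (@seq_sum_sigma _ u); first by rewrite subrK.
by move=> p cp; rewrite /= g'K seq_sum_codes // subr0.
Qed.

Lemma contract_opK : cancel contract_op expand_op.
Proof.
move=> w; apply/funext => s; rewrite /contract_op /expand_op gK.
rewrite [X in _ - X](@seq_sum_sigma _ (w \o g')); first by rewrite addrK.
by move=> p cp; rewrite seq_sum_codes // addr0.
Qed.

Lemma seq_sum_linear a (u w : T2 -> R) t :
  sigma (a *: u + w) t = a * sigma u t + sigma w t.
Proof. by rewrite /seq_sum mulr_sumr -big_split. Qed.

Lemma expand_op_linear : linear_op expand_op.
Proof.
move=> a u w; apply/funext => s; rewrite /expand_op seq_sum_linear !fctE /GRing.scale /=.
by ring.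
Qed.

Lemma contract_op_linear : linear_op contract_op.
Proof.
move=> a u w; apply/funext => s; rewrite /contract_op.
rewrite [_ \o g'](_ : _ = a *: (u \o g') + (w \o g')) //.
rewrite seq_sum_linear !fctE /GRing.scale /=.
by ring.
Qed.

Lemma seq_sum_norm (u : T2 -> R) c t : (forall p, `|u p| <= c) ->
  `|sigma u t| <= k.+2%:R * c.
Proof.
move=> uc; have c0 : 0 <= c := le_trans (normr_ge0 _) (uc [::]).
apply: le_trans (seq_sum_bounded (c := c) _) _ => //.
by rewrite ler_wpM2r // ler_nat size_next_codes.
Qed.

Lemma expand_op_bounded : bounded_op expand_op (1 + k.+2%:R).
Proof.
move=> c u uc s; rewrite mulrDl mul1r; apply: le_trans (ler_normB _ _) _.
by apply: lerD => //; exact: seq_sum_norm.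
Qed.

Lemma contract_op_bounded : bounded_op contract_op (1 + k.+2%:R).
Proof.
move=> c u uc s; rewrite mulrDl mul1r; apply: le_trans (ler_normD _ _) _.
by apply: lerD => //; apply: seq_sum_norm => p; exact: uc.
Qed.

(* Off the comb g is encode, so the two sets can only differ at nodes of A on
   the comb and at nodes that g sends to their codes. *)
Lemma branch_closure_diff A : branches k.+2 A ->
  finite_set (A `\` g @^-1` (branch_closure A `&` codes k)) /\
  finite_set (g @^-1` (branch_closure A `&` codes k) `\` A).
Proof.
move=> brA; have fA := finite_branch_comb brA.
have closure_encode s : branch_closure A (encode s) = A s.
  by rewrite -[RHS]/(A s) -{2}(preimage_closure brA).
split.
  apply: sub_finite_set fA => s [As ngs]; split => //; apply: contrapT => ncs.
  by apply: ngs; rewrite /= gE // closure_encode; split => //; exists s.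
have : finite_set (g @^-1` (@encode k @` (A `&` @comb k))).
  apply: finite_preimage; last exact: finite_image.
  by move=> x y _ _ /(can_inj gK).
apply: sub_finite_set => s [[dgs [s0 _ s0E]] nAs].
have As0 : A s0 by rewrite -closure_encode s0E.
exists s0 => //; split=> //; apply: contrapT => ncs0.
apply: nAs; suff -> : s = s0 by [].
by apply: (can_inj gK); rewrite (gE ncs0).
Qed.

Lemma expand_op_data (u : T2 -> R) (v : branches 2 -> R) :
  JL_data (fun B : branches 2 => val B) u v ->
  JL_data (fun A : branches k.+2 => val A) (expand_op u) (v \o binary_branch).
Proof.
move=> H.
have := JL_data_expand branches2_ad next_codes_nil next_codes_codes (@size_next_codes k)
  finite_next_codes next_codes_branch (@uniq_next_codes k) branch_next_codes_val H.
apply: JL_data_transport (can_inj gK) (Bijective binary_branchK adic_branchK) _ _ => A.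
  exact: (branch_closure_diff (set_mem (valP A))).1.
exact: (branch_closure_diff (set_mem (valP A))).2.
Qed.

Lemma contract_op_data (w : T -> R) (v : branches k.+2 -> R) :
  JL_data (fun A : branches k.+2 => val A) w v ->
  JL_data (fun B : branches 2 => val B) (contract_op w) (v \o adic_branch).
Proof.
move=> H; apply: (JL_data_contract branches2_ad next_codes_nil next_codes_codes
  (@size_next_codes k) finite_next_codes next_codes_branch (@uniq_next_codes k)
  branch_next_codes_val (u := w \o g')).
(* The exceptional sets are the images under [g] of those in [branch_closure_diff], taken for the
   adic branch of [B]. *)
apply: JL_data_transport (can_inj g'K) (Bijective adic_branchK binary_branchK) _ _ H => B.
  have [_] := branch_closure_diff (set_mem (valP (adic_branch B))).
  rewrite (closure_preimage k (set_mem (valP B))) => /(finite_image g).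
  apply: sub_finite_set => t [Bt nt]; exists (g' t); last by rewrite g'K.
  by split=> //=; rewrite g'K.
have [+ _] := branch_closure_diff (set_mem (valP (adic_branch B))).
rewrite (closure_preimage k (set_mem (valP B))) => /(finite_image g).
apply: sub_finite_set => t [Bt nt]; exists (g' t); last by rewrite g'K.
by split=> //=; rewrite g'K.
Qed.

End Main.

Theorem theorem4p3 (R : realType) (p : \bar R) (p1 : (1 < p)%E)
    (m : nat) (m2 : (2 <= m)%N) :
  isomorphic (JL (branches m) p1) (JL (branches 2) p1).
Proof.
case: m m2 => [|[|k]] // _.
(* Redefining [encode] on the comb makes room for the binary nodes that are not codes. *)
have [g [g' gK g'K] gE] := extend_bijection (@encode_inj k) (@infinite_comb k).
exact: (JL_isomorphic p1 (@adic_branchK k) (@binary_branchK k)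
  (contract_opK gK) (expand_opK g'K)
  (contract_op_linear g') (expand_op_linear g)
  (contract_op_bounded g') (expand_op_bounded g)
  (contract_op_data gK g'K gE) (expand_op_data gK gE)).
Qed.
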